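(* When generating modular lattices by the recursive one-element extension procedure for canonical lattices (described in the context), it suffices to consider, for each lattice $L$ reached, only those lattice-antichains $A$ of $L$ that satisfy all of the following conditions, where $k$ is the number of levels of $L\setminus\{0\}$: (A1) $A\subseteq lev_{k-1}(L)$ or $A\subseteq lev_k(L)$; (A2) if $A\subseteq lev_k(L)$, then there are no atoms of $L$ in $lev_{k-1}(L)$; (A3) for all distinct $x,y\in A$, $x$ and $y$ have a common cover in $L$; (A4) if $A\subseteq lev_k(L)$, then $lev_{k-1}(L)$ satisfies lower semimodularity, i.e. for all $x,y\in lev_{k-1}(L)$, if $x\prec x\vee y$ and $y\prec x\vee y$ then $x\wedge y\prec x$ and $x\wedge y\prec y$. That is: for every $N\geq 2$ and every canonical modular $N$-lattice $M$, there are canonical lattices $L_2,L_3,\ldots,L_N=M$, where $L_2$ is the two-element $2$-lattice and each $L_m$ is an $m$-lattice, and lattice-antichains $A_m$ of $L_m$ satisfying (A1), (A2), (A3) and (A4) (with $L=L_m$, $A=A_m$), such that $L_{m+1}=L_m^{A_m}$ for all $2\le m<N$.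
   Context: Write $a\prec b$ if $a$ is covered by $b$. A lattice is modular if $a\geq c$ implies $a\wedge(b\vee c)=(a\wedge b)\vee c$ for all $a,b,c$. An $n$-lattice ($n\ge 2$) is a lattice with underlying set $\{0,1,\ldots,n-1\}$ whose bottom is $0$ and whose top is $1$. For a subset $A$, ${\uparrow}A=\{b\mid b\geq a\text{ for some }a\in A\}$. A lattice-antichain of a lattice $L$ is a nonempty antichain $A\subseteq L\setminus\{0\}$ such that $a\wedge b\in\{0\}\cup{\uparrow}A$ for all $a,b\in{\uparrow}A$. Given an $n$-lattice $L$ and a lattice-antichain $A$ of $L$, $L^A$ is the $(n+1)$-lattice obtained by adding to $L$ a new element $n$ as an atom whose set of covers is $A$ (so $0<n$, $n<x$ iff $x\in{\uparrow}A$ for $x\in L$, and the order on $L$ is unchanged). Levels: for a finite poset $P$, $lev_1(P)$ is the set of maximal elements of $P$, and $lev_{m+1}(P)=lev_1(P\setminus\bigcup_{i=1}^m lev_i(P))$. For an $n$-lattice $L$, $k$ denotes the number of nonempty levels of $L\setminus\{0\}$, so $lev_k(L)$ is the bottom nonzero level (and $lev_j(L)=\emptyset$ for $j\le 0$). Canonical lattices: the weight of an $n$-lattice $L$ is $w(L)=(w_2(L),\ldots,w_{n-1}(L))$ with $w_i(L)=\sum_{i\prec j}2^j$ (sum over the covers $j$ of $i$ in $L$); weights are compared lexicographically. An $n$-lattice $C$ is canonical if no $n$-lattice isomorphic to $C$ has a smaller weight. Recursive procedure: starting from the two-element $2$-lattice, from each canonical $m$-lattice $L$ with $m$ less than the target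 size, form $L^A$ for each considered lattice-antichain $A$ of $L$, and continue recursively with those $L^A$ that are canonical. *)

(* Defs.v *)
From HB Require Import structures.
From mathcomp Require Import all_boot all_order.

Set Implicit Arguments.
Unset Strict Implicit.
Unset Printing Implicit Defensive.

Import Order.TTheory.

Local Open Scope nat_scope.

Section LatticeRel.
Variables (T : finType) (le : rel T).

Definition is_glb (x y m : T) : bool :=
  [&& le m x, le m y & [forall z, le z x && le z y ==> le z m]].

Definition is_lub (x y m : T) : bool :=
  [&& le x m, le y m & [forall z, le x z && le y z ==> le m z]].

Definition is_lattice_rel : bool :=
  [&& [forall x, le x x],
      [forall x, forall y, le x y && le y x ==> (x == y)],
      [forall x, forall y, forall z, le x y && le y z ==> le x z],
      [forall x, forall y, exists m, is_glb x y m] &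
      [forall x, forall y, exists m, is_lub x y m]].

Lemma glb_lub (t : T) :
    reflexive le -> transitive le -> (forall x, le x t) ->
    (forall x y, exists m, is_glb x y m) ->
  forall x y, exists m, is_lub x y m.
Proof.
move=> lexx le_trans let1 glbP x y.
pose U z := le x z && le y z.
have Ut : U t by rewrite /U !let1.
case: (arg_minnP (fun z => #|[pred w | le w z]|) Ut) => u Uu minu.
exists u; case/andP: (Uu) => xu yu; apply/and3P; split=> //.
apply/forallP=> z; apply/implyP=> /andP[xz yz].
have [m /and3P[mu mz /forallP mP]] := glbP u z.
have Um : U m.
  by apply/andP; split; apply: (implyP (mP _)); rewrite ?xu ?yu.
have sub : [pred w | le w m] \subset [pred w | le w u].
  by apply/subsetP=> w; rewrite !inE => wm; apply: le_trans wm mu.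
have [le_mu /esym] := subset_leqif_card sub; rewrite eqn_leq le_mu minu //=.
move=> /subsetP/(_ u); rewrite !inE lexx => /(_ isT) um.
exact: le_trans um mz.
Qed.

End LatticeRel.

(* An n-lattice: a lattice order on {0, ..., n-1}, given by the set of its    *)
(* pairs x <= y, with bottom 0 and top 1.  This is meant for n >= 2; the      *)
(* degenerate cases n = 0, 1 are not excluded so that nlattice m is inhabited *)
(* for every m and families L : forall m, nlattice m make sense.              *)
Definition is_nlattice n (r : {set 'I_n * 'I_n}) : bool :=
  [&& is_lattice_rel [rel x y | (x, y) \in r],
      [forall b : 'I_n, forall x, (b == 0 :> nat) ==> ((b, x) \in r)] &
      [forall t : 'I_n, forall x, (t == 1 :> nat) ==> ((x, t) \in r)]].

Record nlattice (n : nat) := NLattice {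
  nlat_set : {set 'I_n * 'I_n};
  nlat_setP : is_nlattice nlat_set
}.

HB.instance Definition _ n := [isSub for @nlat_set n].
HB.instance Definition _ n := [Finite of nlattice n by <:].

(* The carrier is an alias, since 'I_n itself is already canonically ordered. *)
Definition nlat_sort n (L : nlattice n) : Type := 'I_n.
Coercion nlat_sort : nlattice >-> Sortclass.

HB.instance Definition _ n (L : nlattice n) := Finite.copy (nlat_sort L) 'I_n.

Section NLatticeOrder.
Variables (n : nat) (L : nlattice n).
Implicit Types x y z : L.

Definition label (x : L) : nat := nat_of_ord x.

Definition nle : rel L := fun x y => (x, y) \in nlat_set L.

Let latP : is_lattice_rel nle. Proof. by case/and3P: (nlat_setP L). Qed.

Lemma nle_refl : reflexive nle.
Proof. by case/and5P: latP => /forallP. Qed.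

Lemma nle_anti : antisymmetric nle.
Proof.
move=> x y xy; case/and5P: latP => _ /forallP/(_ x)/forallP/(_ y).
by rewrite xy => /eqP.
Qed.

Lemma nle_trans : transitive nle.
Proof.
move=> y x z xy yz; case/and5P: latP => _ _.
by move=> /forallP/(_ x)/forallP/(_ y)/forallP/(_ z); rewrite xy yz.
Qed.

Lemma nle_glb x y : exists m, is_glb nle x y m.
Proof.
by case/and5P: latP => _ _ _ /forallP/(_ x)/forallP/(_ y)/existsP.
Qed.

Lemma nle_lub x y : exists m, is_lub nle x y m.
Proof.
by case/and5P: latP => _ _ _ _ /forallP/(_ x)/forallP/(_ y)/existsP.
Qed.

Lemma nle_bot x y : label x = 0 -> nle x y.
Proof.
move=> x0; case/and3P: (nlat_setP L) => _ /forallP/(_ x)/forallP/(_ y) + _.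
by move/implyP; apply; apply/eqP.
Qed.

Lemma nle_top x y : label y = 1 -> nle x y.
Proof.
move=> y1; case/and3P: (nlat_setP L) => _ _ /forallP/(_ y)/forallP/(_ x).
by move/implyP; apply; apply/eqP.
Qed.

Definition nmeet x y : L := xchoose (nle_glb x y).
Definition njoin x y : L := xchoose (nle_lub x y).

Lemma nmeetP x y z : nle x (nmeet y z) = nle x y && nle x z.
Proof.
have /and3P[my mz /forallP mP] := xchooseP (nle_glb y z).
apply/idP/idP => [xm|]; last exact: (implyP (mP _)).
by rewrite !(nle_trans xm).
Qed.

Lemma njoinP x y z : nle (njoin x y) z = nle x z && nle y z.
Proof.
have /and3P[xj yj /forallP jP] := xchooseP (nle_lub x y).
apply/idP/idP => [jz|]; last exact: (implyP (jP _)).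
by rewrite (nle_trans xj) ?(nle_trans yj).
Qed.

End NLatticeOrder.

Fact nlat_display : Order.disp_t. Proof. exact: Order.Disp tt tt. Qed.

HB.instance Definition _ n (L : nlattice n) :=
  Order.Le_isPOrder.Build nlat_display (nlat_sort L)
    (@nle_refl n L) (@nle_anti n L) (@nle_trans n L).
HB.instance Definition _ n (L : nlattice n) :=
  Order.POrder_MeetJoin_isLattice.Build nlat_display (nlat_sort L)
    (@nmeetP n L) (@njoinP n L).

Local Open Scope order_scope.

Section FinPOrder.
Variables (d : Order.disp_t) (T : finPOrderType d).
Implicit Types (x y : T) (A P : {set T}).

(* x is covered by y *)
Definition covby x y : bool :=
  (x < y) && [forall z, ~~ ((x < z) && (z < y))].

Definition upset A : {set T} := [set b | [exists a in A, a <= b]].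

Definition antichain A : bool :=
  [forall x in A, forall y in A, (x <= y) ==> (x == y)].

Definition maxima P : {set T} := [set x in P | [forall y in P, ~~ (x < y)]].

(* P without its first m levels *)
Fixpoint lev_rest P (m : nat) : {set T} :=
  if m is m'.+1 then lev_rest P m' :\: maxima (lev_rest P m') else P.

(* Levels are numbered from 1, from the top; see lev_recE. *)
Definition lev P (m : nat) : {set T} :=
  if m is m'.+1 then maxima (lev_rest P m') else set0.

Lemma lev1 P : lev P 1 = maxima P. Proof. by []. Qed.

Lemma lev_recE P m :
  lev P m.+1 = lev (P :\: \bigcup_(1 <= i < m.+1) lev P i) 1.
Proof.
rewrite lev1 /=; congr maxima.
elim: m => [|m IHm] /=; first by rewrite big_geq // setD0.
by rewrite big_nat_recr //= -setDDl -IHm.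
Qed.

Lemma maxima_sub P : maxima P \subset P.
Proof. by apply/subsetP=> x; rewrite inE => /andP[]. Qed.

Lemma maxima_eq0 P : (maxima P == set0) = (P == set0).
Proof.
apply/idP/idP => [|/eqP->]; last by rewrite -subset0 maxima_sub.
apply: contraTT => /set0Pn[x0 Px0].
case: (arg_maxnP (fun x => #|[set w : T | w <= x]|) Px0) => x Px maxx.
apply/set0Pn; exists x; rewrite inE; apply/andP; split; first exact: Px.
apply/forall_inP=> y Py; apply/negP=> xy.
have := maxx y Py; rewrite /= leqNgt => /negP; apply; apply: proper_card.
rewrite properE; apply/andP; split.
  by apply/subsetP=> w; rewrite !inE => /le_trans; apply; apply: ltW.
by apply/subsetPn; exists y; rewrite !inE ?lexx // (lt_geF xy).
Qed.

Lemma lev_eq0 P m : (#|P| < m)%N -> lev P m = set0.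
Proof.
have H : (#|lev_rest P m.-1| <= #|P| - m.-1)%N.
  elim: m.-1 => [|k IHk] /=; first by rewrite subn0.
  have [-> | nz] := eqVneq (lev_rest P k) set0; first by rewrite set0D cards0.
  rewrite subnS; move: nz; rewrite -maxima_eq0 -card_gt0 => nz.
  rewrite cardsD (setIidPr (maxima_sub _)) -ltnS.
  have /leq_trans := IHk; move: nz (subset_leq_card (maxima_sub (lev_rest P k))).
  by move: IHk; case: #|maxima _| => // c; case: #|lev_rest P k| => // e;
     case: (#|P| - k)%N => // f; rewrite !ltnS subSS => ef _ _ _;
     apply: leq_trans ef; rewrite leq_subr.
case: m H => [|m] //= H Pm; apply/eqP; rewrite maxima_eq0 -cards_eq0.
by rewrite -leqn0; apply: leq_trans H _; rewrite leqn0 subn_eq0.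
Qed.

(* Number of nonempty levels; by lev_eq0 only indices up to #|P| matter. *)
Definition nb_lev P : nat := #|[set i : 'I_#|P|.+1 | lev P i != set0]|.

End FinPOrder.

(* (L^A)'s order relation; the new element n is ord_max : 'I_n.+1, and        *)
(* unlift ord_max x is Some x' with x' = x :> nat if x < n, None if x = n.    *)
Definition adjoin_rel n (L : nlattice n) (A : {set L}) : rel 'I_n.+1 :=
  fun x y =>
    match unlift ord_max x : option L, unlift ord_max y : option L with
    | Some x', Some y' => x' <= y'
    | Some x', None => label x' == 0%N
    | None, Some y' => y' \in upset A
    | None, None => true
    end.

Definition lattice_antichain n (L : nlattice n) (A : {set L}) : bool :=
  [&& A != set0, antichain A, [forall x in A, label x != 0%N] &
      [forall a in upset A, forall b in upset A,
        (label (a `&` b) == 0%N) || (a `&` b \in upset A)]].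

Definition adjoin_set n (L : nlattice n) (A : {set L}) : {set 'I_n.+1 * 'I_n.+1} :=
  [set p | adjoin_rel A p.1 p.2].

Section Adjoin.
Variables (n : nat) (L : nlattice n) (A : {set L}).
Hypothesis hA : lattice_antichain A.

Let inA (x : L) : 'I_n.+1 := lift ord_max (x : 'I_n).

Variant adj_spec : 'I_n.+1 -> Type :=
  | AdjNew : adj_spec ord_max
  | AdjOld (x : L) : adj_spec (inA x).

Lemma adjP x : adj_spec x.
Proof. by case: (unliftP ord_max x) => [x'|] ->; [exact: (AdjOld x')|left]. Qed.

Lemma adj_oo (x y : L) : adjoin_rel A (inA x) (inA y) = (x <= y).
Proof. by rewrite /adjoin_rel /inA !liftK. Qed.
Lemma adj_on (x : L) : adjoin_rel A (inA x) ord_max = (label x == 0%N).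
Proof. by rewrite /adjoin_rel /inA !liftK unlift_none. Qed.
Lemma adj_no (y : L) : adjoin_rel A ord_max (inA y) = (y \in upset A).
Proof. by rewrite /adjoin_rel /inA !liftK unlift_none. Qed.
Lemma adj_nn : adjoin_rel A ord_max ord_max.
Proof. by rewrite /adjoin_rel !unlift_none. Qed.
Let adjE := (adj_oo, adj_on, adj_no, adj_nn).

Lemma label_inj : injective (@label n L).
Proof. exact: val_inj. Qed.

Lemma label0_le (x y : L) : label x = 0%N -> x <= y.
Proof. exact: nle_bot. Qed.

Lemma le_label0 (x y : L) : x <= y -> label y = 0%N -> label x = 0%N.
Proof. by move=> xy y0; have <- : y = x by apply/le_anti; rewrite xy label0_le. Qed.

Lemma upsetP (x : L) : reflect (exists2 a, a \in A & a <= x) (x \in upset A).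
Proof. by rewrite inE; apply: exists_inP. Qed.

Lemma upset_label (x : L) : x \in upset A -> label x <> 0%N.
Proof.
case/and4P: hA => _ _ /forall_inP nz _ /upsetP[a aA ax] x0.
by have /eqP := nz a aA; apply; apply: le_label0 ax x0.
Qed.

Lemma upset_le (x y : L) : x <= y -> x \in upset A -> y \in upset A.
Proof.
move=> xy /upsetP[a aA ax]; apply/upsetP; exists a => //; exact: le_trans xy.
Qed.

Lemma size_gt1 : (1 < n)%N.
Proof.
case/and4P: hA => /set0Pn[a aA] _ /forall_inP/(_ a aA) a0 _.
by apply: leq_trans (ltn_ord (a : 'I_n)); rewrite ltnS lt0n.
Qed.

Lemma adj_refl : reflexive (adjoin_rel A).
Proof. by move=> x; case/adjP: x => [|x]; rewrite adjE. Qed.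

Lemma adj_anti : antisymmetric (adjoin_rel A).
Proof.
move=> x y; case/adjP: x => [|x]; case/adjP: y => [|y]; rewrite !adjE //.
- by case/andP=> /upset_label yn /eqP.
- by case/andP=> /eqP x0 /upset_label.
- by move=> /le_anti->.
Qed.

Lemma adj_trans : transitive (adjoin_rel A).
Proof.
move=> y x z; case/adjP: x => [|x]; case/adjP: y => [|y];
  case/adjP: z => [|z]; rewrite !adjE //.
- by move=> yA yz; apply: upset_le yA.
- by move=> /eqP x0 _; apply: label0_le.
- by move=> xy /eqP y0; rewrite (le_label0 xy).
- exact: le_trans.
Qed.

Lemma adj_glb x y : exists m, is_glb (adjoin_rel A) x y m.
Proof.
have n_gt0 : (0 < n)%N := ltnW size_gt1.
pose b : L := Ordinal n_gt0.
have b0 : label b = 0%N by [].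
have glb_new (z : L) : exists m, is_glb (adjoin_rel A) ord_max (inA z) m.
  have [zA | zA] := boolP (z \in upset A).
    exists ord_max; rewrite /is_glb !adjE zA /=.
    by apply/forallP=> w; apply/implyP=> /andP[].
  exists (inA b); rewrite /is_glb !adjE b0 eqxx label0_le //=.
  apply/forallP=> w; case/adjP: w => [|w]; rewrite !adjE ?(negbTE zA) //.
  by apply/implyP=> /andP[/eqP w0 _]; apply: label0_le.
case/adjP: x => [|x]; case/adjP: y => [|y]; last 1 first.
- case/and4P: hA => _ _ _ /forall_inP hmeet.
  have [/andP[xA yA] | xyA] := boolP ((x \in upset A) && (y \in upset A)).
    have /orP[/eqP m0 | mA] := forall_inP (hmeet x xA) y yA.
      exists ord_max; rewrite /is_glb !adjE xA yA /=.
      apply/forallP=> w; case/adjP: w => [|w]; rewrite !adjE ?implybT //.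
      by rewrite -lexI; apply/implyP=> /le_label0/(_ m0)->.
    exists (inA (x `&` y)); rewrite /is_glb !adjE leIl leIr /=.
    apply/forallP=> w; case/adjP: w => [|w]; rewrite !adjE ?mA ?implybT //.
    by rewrite lexI implybb.
  exists (inA (x `&` y)); rewrite /is_glb !adjE leIl leIr /=.
  apply/forallP=> w; case/adjP: w => [|w]; rewrite !adjE ?(negbTE xyA) //.
  by rewrite lexI implybb.
- exists ord_max; rewrite /is_glb !adjE /=.
  by apply/forallP=> w; apply/implyP=> /andP[].
- exact: glb_new.
- have [m /and3P[m1 m2 /forallP m3]] := glb_new x; exists m.
  by apply/and3P; split=> //; apply/forallP=> w; rewrite andbC.
Qed.

Lemma adjoin_subproof : is_nlattice (adjoin_set A).
Proof.
have relE : [rel x y | (x, y) \in adjoin_set A] =2 adjoin_rel A.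
  by move=> x y /=; rewrite inE.
have lab (x : L) : inA x = label x :> nat by rewrite /= /bump leqNgt ltn_ord.
have top (x t : 'I_n.+1) : t = 1%N :> nat -> adjoin_rel A x t.
  case/adjP: t => [/= n1|t]; first by have /gtn_eqF/eqP := size_gt1.
  rewrite lab => t1; have leT (z : L) : z <= t by apply: nle_top.
  case/adjP: x => [|x]; rewrite adjE //.
  case/and4P: hA => /set0Pn[a aA] _ _ _; apply/upsetP; exists a => //.
have lubP := glb_lub adj_refl adj_trans
  (fun x => top x (lift ord_max (Ordinal size_gt1)) (lab _)) adj_glb.
apply/and3P; split.
- apply/and5P; split.
  + by apply/forallP=> x; rewrite relE adj_refl.
  + apply/forallP=> x; apply/forallP=> y; rewrite !relE.
    by apply/implyP=> /adj_anti->.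
  + do 3!apply/forallP=> ?; rewrite !relE; apply/implyP=> /andP[].
    exact: adj_trans.
  + apply/forallP=> x; apply/forallP=> y; apply/existsP.
    have [m /and3P[m1 m2 m3]] := adj_glb x y; exists m; rewrite /is_glb !relE m1 m2.
    by apply/forallP=> z; rewrite !relE; apply: (forallP m3).
  + apply/forallP=> x; apply/forallP=> y; apply/existsP.
    have [m /and3P[m1 m2 m3]] := lubP x y; exists m; rewrite /is_lub !relE m1 m2.
    by apply/forallP=> z; rewrite !relE; apply: (forallP m3).
- apply/forallP=> b; apply/forallP=> x; apply/implyP; rewrite inE /=.
  case/adjP: b => [/eqP /= n0|b]; first by have /gtn_eqF/eqP := ltnW size_gt1.
  rewrite lab => /eqP b0; case/adjP: x => [|x]; rewrite adjE ?b0 //.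
  exact: label0_le.
- apply/forallP=> t; apply/forallP=> x; apply/implyP=> /eqP t1.
  by rewrite inE; apply: top.
Qed.

(* L^A *)
Definition adjoin : nlattice n.+1 := NLattice adjoin_subproof.

End Adjoin.

Lemma two_lattice_subproof :
  is_nlattice [set p : 'I_2 * 'I_2 | (p.1 <= p.2)%N].
Proof.
have o2 (P : pred 'I_2) : P ord0 -> P ord_max -> [forall x, P x].
  move=> P0 P1; apply/forallP=> -[[|[|//]] i].
    by rewrite (_ : Ordinal i = ord0) //; apply: val_inj.
  by rewrite (_ : Ordinal i = ord_max) //; apply: val_inj.
apply/and3P; split; last 2 first.
- by apply: (o2); apply: (o2); rewrite ?inE.
- by apply: (o2); apply: (o2); rewrite ?inE.
apply/and5P; split.
- by apply/forallP=> x; rewrite /= inE.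
- apply/forallP=> x; apply/forallP=> y /=; rewrite !inE /= -eqn_leq.
  exact: implybb.
- do 3!apply/forallP=> ?; rewrite /= !inE /=; apply/implyP=> /andP[].
  exact: leq_trans.
- apply/forallP=> x; apply/forallP=> y; apply/existsP.
  case: (leqP x y) => xy; [exists x | exists y]; apply/and3P;
    (split; last by apply/forallP=> z; apply/implyP=> /andP[]);
    by rewrite /= inE //= ltnW.
- apply/forallP=> x; apply/forallP=> y; apply/existsP.
  case: (leqP x y) => xy; [exists y | exists x]; apply/and3P;
    (split; last by apply/forallP=> z; apply/implyP=> /andP[]);
    by rewrite /= inE //= ltnW.
Qed.

Definition two_lattice : nlattice 2 := NLattice two_lattice_subproof.

Definition modular n (L : nlattice n) : Prop :=
  forall a b c : L, c <= a -> a `&` (b `|` c) = (a `&` b) `|` c.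

Definition isomorphic n (L L' : nlattice n) : Prop :=
  exists2 f : L -> L', bijective f & {mono f : x y / x <= y}.

(* (w_2(L), ..., w_{n-1}(L)), as enum {: L} lists 0, ..., n-1 in this order. *)
Definition weight n (L : nlattice n) : seq nat :=
  [seq (\sum_(j : L | covby i j) 2 ^ label j)%N | i <- enum {: L} & (2 <= label i)%N].

Definition canonical n (L : nlattice n) : Prop :=
  forall L' : nlattice n, isomorphic L' L ->
    ~~ ((weight L' : seqlexi nat) < weight L).

Section Conditions.
Variables (n : nat) (L : nlattice n) (A : {set L}).

Definition atom (x : L) : bool := [exists z : L, (label z == 0%N) && covby z x].

(* lev_j(L) *)
Definition llev (j : nat) : {set L} := lev [set: L] j.

(* k, the number of levels of L \ {0} *)
Definition depth : nat := nb_lev [set x : L | label x != 0%N].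

Definition condA1 : Prop := A \subset llev depth.-1 \/ A \subset llev depth.

Definition condA2 : Prop :=
  A \subset llev depth -> forall x, x \in llev depth.-1 -> ~~ atom x.

Definition condA3 : Prop :=
  forall x y, x \in A -> y \in A -> x != y -> exists z, covby x z && covby y z.

Definition condA4 : Prop :=
  A \subset llev depth ->
  forall x y, x \in llev depth.-1 -> y \in llev depth.-1 ->
    covby x (x `|` y) -> covby y (x `|` y) ->
    covby (x `&` y) x /\ covby (x `&` y) y.

End Conditions.

(* Main.v *)
Require Import Defs.
From mathcomp Require Import all_boot all_order.
From mathcomp Require Import fingroup perm zify.

(* The corank r x of an element x is the length of the longest chain going up
   from x; the levels of any up-set are the sets on which r is constant.
   Exchanging two labels shows that the labelling of a canonical lattice is
   compatible with the levels: a nonzero element of smaller corank has a smaller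
   label. Hence the labels below m of a canonical lattice M form a lattice L_m,
   the bottom together with an up-set of M. The first weights of M are those of
   L_m, so a relabelling of L_m of smaller weight would give one of M, and L_m is
   canonical too. L_(m+1) is obtained from L_m by adding m below the set A of its
   covers in M.
   The L_m need not be modular, so the four conditions are derived inside M,
   whose modularity makes r drop by exactly one along covers. Therefore all
   elements of A have corank r m - 1, while L_m has r m or r m - 1 levels; and
   every element of M whose corank is less than r m already lies in L_m, which
   provides the lower covers and meets required by (A2) and (A4). *)

Set Implicit Arguments.
Unset Strict Implicit.
Unset Printing Implicit Defensive.

Import Order.TTheory.

Local Open Scope order_scope.

(** * Covers and levels in finite posets *)

Section FinPOrder.
Variables (d : Order.disp_t) (T : finPOrderType d).
Implicit Types (x y z : T) (P : {set T}) (r : T -> nat).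

Lemma covbyP x y :
  reflect (x < y /\ forall z, x < z -> z < y -> False) (covby x y).
Proof.
apply: (iffP andP) => -[xy H]; split=> //.
  by move=> z xz zy; move/forallP/(_ z): H; rewrite xz zy.
by apply/forallP=> z; apply/negP=> /andP[/H].
Qed.

Lemma covby_lt x y : covby x y -> x < y.
Proof. by case/andP. Qed.

Lemma covby_le_eq x y z : covby x y -> x <= z -> z <= y -> z = x \/ z = y.
Proof.
case/covbyP=> _ H; rewrite le_eqVlt => /orP[/eqP->|xz]; first by left.
by rewrite le_eqVlt => /orP[/eqP->|/(H _ xz)]; first by right.
Qed.

Lemma covby_antichain x y z : covby x y -> covby x z -> y <= z -> y = z.
Proof.
move=> xy /covbyP[_ H]; rewrite le_eqVlt => /orP[/eqP//|].
by move/H; case; apply: covby_lt.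
Qed.

Lemma card_above_lt x y :
  x < y -> (#|[pred z | (y < z)%O]| < #|[pred z | (x < z)%O]|)%N.
Proof.
move=> xy; apply: proper_card; rewrite properE; apply/andP; split.
  by apply/subsetP=> z; rewrite !inE; apply: lt_trans.
by apply/subsetPn; exists y; rewrite !inE ?ltxx.
Qed.

Lemma card_below_lt x y :
  x < y -> (#|[pred z | (z < x)%O]| < #|[pred z | (z < y)%O]|)%N.
Proof.
move=> xy; apply: proper_card; rewrite properE; apply/andP; split.
  by apply/subsetP=> z; rewrite !inE => /lt_trans; apply.
by apply/subsetPn; exists x; rewrite !inE ?ltxx.
Qed.

Lemma upper_cover x y : x < y -> exists2 z, covby x z & z <= y.
Proof.
move=> xy; pose U z := (x < z) && (z <= y).
have Uy : U y by rewrite /U xy lexx.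
case: (arg_maxnP (fun z => #|[pred w | (z < w)%O]|) Uy) => z /andP[xz zy] H.
exists z => //; apply/covbyP; split=> // w xw wz.
have := H w; rewrite /U xw (le_trans (ltW wz)) // => /(_ isT).
by rewrite /= leqNgt card_above_lt.
Qed.

Lemma lower_cover x y : x < y -> exists2 z, covby z y & x <= z.
Proof.
move=> xy; pose U z := (x <= z) && (z < y).
have Ux : U x by rewrite /U xy lexx.
case: (arg_maxnP (fun z => #|[pred w | (w < z)%O]|) Ux) => z /andP[xz zy] H.
exists z => //; apply/covbyP; split=> // w zw wy.
have := H w; rewrite /U wy (le_trans xz (ltW zw)) // => /(_ isT).
by rewrite /= leqNgt card_below_lt.
Qed.

(** The empty maximum is 0, so maximal elements have value 1, the index of the first level. *)
Definition corank r := forall x, r x = (\max_(y | (x < y)%O) r y).+1.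

(** Iterating the recursion, the value at [x] is stable once the number of steps exceeds the number
    of elements strictly above [x]. *)
Lemma corank_exists : exists r, corank r.
Proof.
pose F r x := (\max_(y | (x < y)%O) r y).+1.
pose R k := iter k F (fun=> 0%N).
have stable k x : (#|[pred y | (x < y)%O]| < k)%N -> R k x = R k.+1 x.
  elim: k x => // k IHk x xk; congr _.+1; apply: eq_bigr => y xy.
  by apply: IHk; apply: leq_trans (card_above_lt xy) _.
exists (R #|T|.+1) => x; apply: (stable #|T|.+1).
by rewrite ltnS max_card.
Qed.

(** What makes the fibres of [r] on [P] the levels of [P]. It is independent of [corank] because it
    also serves for a function [rL] on a restriction of [M]. *)
Definition rank_on P r :=
  [/\ forall x, x \in P -> (0 < r x)%N,
      forall x y, x \in P -> y \in P -> x < y -> (r y < r x)%N &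
      forall x, x \in P -> (1 < r x)%N ->
        exists2 y, y \in P & x < y /\ (r y).+1 = r x].

(** Removing the first [j] levels leaves the elements of value above [j], and the maximal ones among
    these have value [j.+1]. *)
Lemma lev_rank P r j : rank_on P r -> lev P j = [set x in P | r x == j].
Proof.
case=> r0 rlt rex.
have max_rank k : maxima [set x in P | (k < r x)%N] = [set x in P | r x == k.+1].
  apply/setP=> x; rewrite !inE; have [xP/=|//] := boolP (x \in P).
  apply/andP/eqP => [[kx /forall_inP H] | xk].
    apply/eqP; rewrite eqn_leq kx andbT leqNgt; apply/negP=> kx1.
    have [|y yP [xy ry]] := rex x xP; first by apply: leq_ltn_trans kx1.
    by have := H y; rewrite inE yP xy -ltnS ry => /(_ kx1).
  split; first by rewrite xk.
  apply/forall_inP=> y; rewrite inE => /andP[yP ky]; apply/negP=> xy.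
  by have := rlt _ _ xP yP xy; rewrite xk ltnS leqNgt ky.
case: j => [|j].
  by apply/setP=> x; rewrite !inE; case: (boolP (x \in P)) => // /r0; case: (r x).
rewrite /= -max_rank; congr maxima; elim: j => [|j /= ->].
  by apply/setP=> x; rewrite !inE; case: (boolP (x \in P)) => // /r0->.
apply/setP=> x; rewrite max_rank !inE.
by case: (x \in P) => //=; rewrite [RHS]ltn_neqAle eq_sym.
Qed.

Lemma nb_lev_rank P r D :
    rank_on P r -> (forall x, x \in P -> (r x <= D)%N) ->
    (exists2 x, x \in P & r x = D) ->
  nb_lev P = D.
Proof.
move=> rP rD [x0 x0P x0D].
(* Going up from [x0] by the last clause of [rank_on] meets every value from [D] down to 1. *)
have levP j : (0 < j <= D)%N -> lev P j != set0.
  case/andP=> j0 jD; rewrite (lev_rank _ rP); apply/set0Pn.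
  have [k] : exists k, D = (j + k)%N by exists (D - j)%N; lia.
  elim: k j j0 {jD} => [|k IHk] j j0 E.
    by exists x0; rewrite inE x0P x0D E addn0 eqxx.
  have [|x] := IHk j.+1 isT; first lia.
  rewrite inE => /andP[xP /eqP xj]; case: rP => _ _ /(_ x xP).
  rewrite xj ltnS => /(_ j0)[y yP [_ [yj]]].
  by exists y; rewrite inE yP yj eqxx.
have D0 : (0 < D)%N by rewrite -x0D; case: rP => /(_ x0 x0P).
have DP : (D <= #|P|)%N.
  rewrite leqNgt; apply/negP=> /lev_eq0 E.
  by have := levP D; rewrite D0 leqnn E eqxx => /(_ isT).
rewrite /nb_lev.
have -> : [set i : 'I_#|P|.+1 | lev P i != set0] =
          [set i : 'I_#|P|.+1 | (i < D.+1)%N] :\ ord0.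
  apply/setP=> i; rewrite !inE -(inj_eq val_inj) /= -lt0n ltnS.
  apply/idP/idP=> [|/levP//].
  rewrite (lev_rank _ rP) => /set0Pn[x]; rewrite inE => /andP[xP /eqP ri].
  by have := rD x xP; case: rP => /(_ x xP); rewrite ri => -> _ _ ->.
apply/eqP; rewrite -eqSS; apply/eqP.
have := cardsD1 (ord0 : 'I_#|P|.+1) [set i : 'I_#|P|.+1 | (i < D.+1)%N].
rewrite inE /= add1n => <-; rewrite -sum1_card.
under eq_bigl => i do rewrite inE.
by rewrite big_ord_narrow ?ltnS // sum1_card card_ord.
Qed.

End FinPOrder.

(** * Modularity and corank *)

Section Modular.
Variables (n : nat) (L : nlattice n).
Hypothesis hmod : modular L.
Implicit Types w x y z : L.

(** By the modular law, a [z] strictly between [x] and the join is the join of [x] with the meet of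
    [z] and [y]; as [w] is covered by [y], that meet is [w] or [y]. *)
Lemma modular_upper w x y :
  covby w x -> covby w y -> x != y -> covby x (x `|` y).
Proof.
move=> wx wy xy; have wltx := covby_lt wx; have wlty := covby_lt wy.
apply/covbyP; split=> [|z xz zxy].
  rewrite lt_neqAle leUl andbT; apply: contra_neqN xy => /eqP xE.
  by symmetry; apply: (covby_antichain wy wx); rewrite xE leUr.
have zE : z = (z `&` y) `|` x.
  by rewrite -(hmod _ (ltW xz)) joinC; apply/esym/meet_idPl/ltW.
have wzy : w <= z `&` y by rewrite lexI !ltW // (lt_trans wltx).
case: (covby_le_eq wy wzy (leIr _ _)) => E; rewrite E in zE.
  by rewrite zE (join_idPr (ltW wltx)) ltxx in xz.
by rewrite zE joinC ltxx in zxy.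
Qed.

(** The dual argument: [z] is the meet of [x] with the join of [y] and [z], and that join is [y] or
    the join of [x] and [y]. *)
Lemma modular_lower x y :
  covby x (x `|` y) -> covby y (x `|` y) -> covby (x `&` y) x.
Proof.
move=> xj yj; have xltj := covby_lt xj; have yltj := covby_lt yj.
apply/covbyP; split=> [|z xyz zx].
  rewrite lt_neqAle leIl andbT; apply/eqP=> xE.
  have /join_idPr jE : x <= y by rewrite -xE leIr.
  by rewrite jE ltxx in yltj.
have zE : z = x `&` (y `|` z).
  by rewrite (hmod _ (ltW zx)); apply/esym/join_idPr/ltW.
have yzj : y `|` z <= x `|` y by rewrite leUx leUr (le_trans (ltW zx)) ?leUl.
case: (covby_le_eq yj (leUl _ _) yzj) => E; rewrite E in zE.
  by rewrite zE ltxx in xyz.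
by rewrite zE (meet_idPl (ltW xltj)) ltxx in zx.
Qed.

End Modular.

Section Corank.
Variables (n : nat) (L : nlattice n) (r : L -> nat).
Hypothesis rP : corank r.
Implicit Types w x y z : L.

Lemma corank_lt x y : x < y -> (r y < r x)%N.
Proof. by move=> xy; rewrite [X in (_ < X)%N]rP ltnS leq_bigmax_cond. Qed.

Lemma corank_gt0 x : (0 < r x)%N. Proof. by rewrite rP. Qed.

Lemma corank_le x y : x <= y -> (r y <= r x)%N.
Proof. by rewrite le_eqVlt => /orP[/eqP->|/corank_lt/ltnW]. Qed.

Lemma corank_cover x : (1 < r x)%N -> exists2 y, covby x y & (r y).+1 = r x.
Proof.
move=> x1; have [y0 xy0] : exists y, x < y.
  apply/existsP; apply: contraTT x1 => /existsPn H.
  by rewrite rP big_pred0 // => y; apply/negbTE/H.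
have [y xy E] := @eq_bigmax_cond _ [pred y | x < y] r (introT card_gt0P (ex_intro _ y0 xy0)).
have rxy : (r y).+1 = r x by rewrite [RHS]rP; congr _.+1; exact: esym.
exists y => //; apply/covbyP; split=> // z /corank_lt xz /corank_lt zy.
lia.
Qed.

Hypothesis hmod : modular L.

(* Jordan-Dedekind: compare [y] with a cover [z] of [x] of the largest
   corank; both are covered by their join. *)
Lemma corank_covby x y : covby x y -> r x = (r y).+1.
Proof.
have [k] := ubnP (r x); elim: k x y => // k IHk x y xk xy.
have xlty := corank_lt (covby_lt xy).
have [|z xz rz] := @corank_cover x; first by apply: leq_ltn_trans xlty; exact: corank_gt0.
have [->//|yz] := eqVneq y z.
have yj := modular_upper hmod xy xz yz.
have zj : covby z (y `|` z) by rewrite joinC; apply: modular_upper xz xy _; rewrite // eq_sym.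
rewrite -rz (IHk _ _ _ zj) -?(IHk _ _ _ yj) //; lia.
Qed.

End Corank.

(** * Weights *)

Lemma lexi_mapP (I : eqType) (s : seq I) (f g : I -> nat) :
  ((map f s : seqlexi nat) < map g s) <->
  (exists s1 x s2, [/\ s = s1 ++ x :: s2, {in s1, f =1 g} & (f x < g x)%N]).
Proof.
elim: s => [|a s IHs] /=; first by split=> // -[[|? ?] [x [s2 []]]].
rewrite ltxi_cons; split.
  case/andP; rewrite leEnat => fga; rewrite leqNgt implyNb.
  have [lta _|gfa /=] := ltnP (f a) (g a); first by exists [::], a, s; split.
  case/IHs=> s1 [x [s2 [-> H fgx]]]; exists (a :: s1), x, s2; split=> // y.
  by rewrite inE => /orP[/eqP->|/H//]; apply/eqP; rewrite eqn_leq fga.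
case=> -[|b s1] [x [s2 [/= [<-]]]].
  by move=> _ _ fga; rewrite leEnat ltnW // leqNgt fga.
move=> E H fgx; rewrite (H a) ?mem_head // lexx /=; apply/IHs.
by exists s1, x, s2; split=> // y ys; apply: H; rewrite inE ys orbT.
Qed.

Definition cover_weight n (L : nlattice n) (x : L) : nat :=
  \sum_(y : L | covby x y) 2 ^ label y.

Lemma weight_ltP n (L L' : nlattice n) :
  ((weight L' : seqlexi nat) < weight L) <->
  (exists2 i : 'I_n, (1 < i)%N &
     (@cover_weight n L' i < @cover_weight n L i)%N /\
     forall t : 'I_n, (1 < t < i)%N -> @cover_weight n L' t = @cover_weight n L t).
Proof.
pose s := [seq i : 'I_n <- enum 'I_n | (1 < i)%N].
have s_sorted : sorted (fun i j : 'I_n => i < j)%N s.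
  apply: sorted_filter; first by move=> ? ? ?; apply: ltn_trans.
  have := iota_ltn_sorted 0 n.
  by rewrite -val_enum_ord sorted_map.
have s_split s1 (x : 'I_n) s2 (t : 'I_n) :
    s = s1 ++ x :: s2 -> (1 < t < x)%N = (t \in s1).
  move=> E; move: s_sorted; rewrite E sorted_pairwise; last first.
    by move=> ? ? ?; apply: ltn_trans.
  rewrite pairwise_cat pairwise_cons => /and3P[/allrelP H1 _ /andP[/allP H2 _]].
  apply/idP/idP => [/andP[t1 tx]|ts1].
    have : t \in s by rewrite mem_filter t1 mem_enum.
    rewrite E mem_cat inE => /or3P[//|/eqP tE|/H2]; first by rewrite tE ltnn in tx.
    by rewrite ltnNge ltnW.
  rewrite H1 ?mem_head // andbT.
  have : t \in s by rewrite E mem_cat ts1.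
  by rewrite mem_filter => /andP[].
have -> : weight L = map (@cover_weight n L) s by [].
have -> : weight L' = map (@cover_weight n L') s by [].
rewrite lexi_mapP; split.
  case=> s1 [x [s2 [E H xw]]]; exists x; last first.
    by split=> // t; rewrite (s_split _ _ _ _ E) => /H.
  have : x \in s by rewrite E mem_cat inE eqxx orbT.
  by rewrite mem_filter => /andP[].
case=> i i1 [iw H]; have /splitPr : i \in s by rewrite mem_filter i1 mem_enum.
case E : _ / => [s1 s2]; exists s1, i, s2; split=> // t ts1; apply: H.
by rewrite (s_split _ _ _ _ E).
Qed.

(** Hence a single cover labelled [c] outweighs any set of covers labelled below [c]. *)
Lemma sum_pow2_lt n (P : pred 'I_n) (c : nat) :
  (c <= n)%N -> (forall j, P j -> (j < c)%N) -> (\sum_(j | P j) 2 ^ j < 2 ^ c)%N.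
Proof.
move=> cn Pc; have sumE k : (\sum_(j < k) 2 ^ j < 2 ^ k)%N.
  elim: k => [|k IHk]; first by rewrite big_ord0.
  by rewrite big_ord_recr expnS mul2n -addnn /= ltn_add2r.
apply: leq_ltn_trans (sumE c).
rewrite -(big_ord_narrow (F := fun j : 'I_n => 2 ^ j)%N cn).
rewrite [leqRHS](bigID P) /= (eq_bigl (fun j : 'I_n => (j < c) && P j)%N).
  exact: leq_addr.
by move=> j; case Pj: (P j); rewrite ?andbF // Pc.
Qed.

(** * Relabellings and restrictions of n-lattices *)

Section Pullback.
Variables (m n : nat) (K : nlattice n) (f : 'I_m -> K).
Hypotheses (m_gt0 : (0 < m)%N) (f_inj : injective f).
Hypothesis f_bot : forall x : 'I_m, x = 0 :> nat -> label (f x) = 0.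
Hypothesis f_top : forall x : 'I_m, x = 1 :> nat -> label (f x) = 1.
Hypothesis f_join : forall x y, exists z, f z = f x `|` f y.

(** Joins are those of [K]. Meets of [K] may leave the image of [f], but finiteness and the bottom
    provide meets, by [glb_lub] for the reversed order. *)
Lemma pullback_is_nlattice : is_nlattice [set p | f p.1 <= f p.2].
Proof.
pose R : rel 'I_m := [rel x y | (x, y) \in [set p | f p.1 <= f p.2]].
have RE x y : R x y = (f x <= f y) by rewrite /R /= inE.
have lub x y : exists z, is_lub R x y z.
  have [z zE] := f_join x y; exists z; rewrite /is_lub !RE zE leUl leUr.
  by apply/forallP=> t; rewrite !RE zE leUx implybb.
have f_le0 (b x : 'I_m) : b = 0 :> nat -> f b <= f x.
  by move=> b0; apply/label0_le/f_bot.
have glb : forall x y, exists z, is_glb R x y z.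
  apply: (@glb_lub _ (fun x y => R y x) (Ordinal m_gt0)) => //.
  - by move=> x /=; rewrite RE.
  - by move=> y x z /=; rewrite !RE => yx zy; apply: le_trans yx.
  - by move=> x /=; rewrite RE f_le0.
rewrite /is_nlattice -/R; apply/and3P; split; first (apply/and5P; split).
- by apply/forallP=> x; rewrite RE.
- apply/forallP=> x; apply/forallP=> y; rewrite !RE; apply/implyP.
  by move=> /le_anti/f_inj->.
- do 3!apply/forallP=> ?; rewrite !RE; apply/implyP=> /andP[].
  exact: le_trans.
- by do 2!apply/forallP=> ?; apply/existsP.
- by do 2!apply/forallP=> ?; apply/existsP.
- by do 2!apply/forallP=> ?; apply/implyP=> /eqP ?; rewrite inE f_le0.
- do 2!apply/forallP=> ?; apply/implyP=> /eqP ?; rewrite inE.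
  by apply/nle_top/f_top.
Qed.

Lemma pullback_exists :
  exists L : nlattice m, forall x y : L, (x <= y) = (f x <= f y).
Proof. by exists (NLattice pullback_is_nlattice) => x y; rewrite [LHS]inE. Qed.

End Pullback.

(* A default value for [L m] when [m] is not between [2] and [N]. *)
Lemma chain_nlattice m : nlattice m.
Proof.
(* The value [m] puts 1 above all other labels: the chain is 0, 2, ..., [m - 1], 1. *)
pose f (x : 'I_m) : nat := if x == 1 :> nat then m else x.
have f_inj : injective f.
  move=> x y; rewrite /f => E; apply: val_inj => /=.
  have := ltn_ord x; have := ltn_ord y; move: E.
  by case: eqP; case: eqP; lia.
exists [set p | (f p.1 <= f p.2)%N].
pose R : rel 'I_m := [rel x y | (x, y) \in [set p | (f p.1 <= f p.2)%N]].
have RE x y : R x y = (f x <= f y)%N by rewrite /R /= inE.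
rewrite /is_nlattice -/R; apply/and3P; split; first (apply/and5P; split).
- by apply/forallP=> x; rewrite RE.
- apply/forallP=> x; apply/forallP=> y; rewrite !RE; apply/implyP.
  by rewrite -eqn_leq => /eqP/f_inj->.
- do 3!apply/forallP=> ?; rewrite !RE; apply/implyP=> /andP[].
  exact: leq_trans.
- apply/forallP=> x; apply/forallP=> y; apply/existsP.
  have [xy|/ltnW yx] := leqP (f x) (f y); [exists x|exists y];
  by rewrite /is_glb !RE ?xy ?yx leqnn; apply/forallP=> z; rewrite !RE;
     apply/implyP=> /andP[].
- apply/forallP=> x; apply/forallP=> y; apply/existsP.
  have [xy|/ltnW yx] := leqP (f x) (f y); [exists y|exists x];
  by rewrite /is_lub !RE ?xy ?yx leqnn; apply/forallP=> z; rewrite !RE;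
     apply/implyP=> /andP[].
- by do 2!apply/forallP=> ?; apply/implyP=> /eqP b0; rewrite inE /f b0.
- do 2!apply/forallP=> ?; apply/implyP=> /eqP t1; rewrite inE /f t1 eqxx.
  by case: eqP => // _; apply: ltnW.
Qed.

Lemma mono_covby (d d' : Order.disp_t) (T : finPOrderType d)
    (T' : finPOrderType d') (f : T -> T') :
  bijective f -> {mono f : x y / x <= y} -> {mono f : x y / covby x y}.
Proof.
case=> g fK gK f_mono x y; have f_lt := leW_mono f_mono.
apply/covbyP/covbyP => -[xy H]; (split; first by rewrite ?f_lt // -f_lt) => z xz zy.
  by apply: (H (f z)); rewrite f_lt.
by apply: (H (g z)); rewrite -f_lt gK.
Qed.

Section Relabel.
Variables (n : nat) (M : nlattice n).
Hypothesis hcan : canonical M.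

(* [M'] is [M] with the label [i] moved to the element labelled [s i]. *)
Lemma canonical_relabel (s : {perm 'I_n}) :
    (forall x : 'I_n, (x < 2)%N -> s x = x) ->
  exists2 M' : nlattice n,
    forall x y, @nle n M' x y = @nle n M (s x) (s y) &
    ~~ ((weight M' : seqlexi nat) < weight M).
Proof.
move=> s2; have [n0|n_gt0] := posnP n.
  exists M; last by apply: hcan; exists id => //; exists id.
  by move=> x; have := ltn_ord (x : 'I_n); rewrite [X in (_ < X)%N]n0.
have [|x x0|x x1|x y|M' M'E] := @pullback_exists n n M s n_gt0.
- exact: perm_inj.
- by rewrite /label s2 x0.
- by rewrite /label s2 x1.
- by exists ((s^-1)%g ((s x : M) `|` s y)); rewrite permKV.
exists M' => //; apply: hcan; exists s => //.
by exists (s^-1)%g; [apply: permK | apply: permKV].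
Qed.

Variable r : M -> nat.
Hypothesis rP : corank r.

(* Otherwise let [i] be the least label with [r j < r i] for some [j > i], and
   choose [j > i] with [r j] least. All covers of [j] are then labelled below
   every element of corank at least [r j], in particular below some cover of
   [i], so exchanging the labels of [i] and [j] decreases the [i]-th weight;
   the earlier weights do not change. *)
Lemma canonical_levelized (x y : M) :
  label x <> 0 -> label y <> 0 -> (r x < r y)%N -> (label x < label y)%N.
Proof.
move=> x0 y0 rxy; rewrite ltnNge leq_eqVlt; apply/negP=> /orP[/eqP/label_inj yx|yx].
  by rewrite yx ltnn in rxy.
pose bad i := (label i != 0)%N && [exists j : M, (label i < label j) && (r j < r i)]%N.
have bad_y : bad y.
  by apply/andP; split; [apply/eqP|apply/existsP; exists x; rewrite yx].
case: (arg_minnP (@label n M) bad_y) => i /andP[i0 /existsP[j0 /andP[ij0 rj0]]] i_min.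
case: (arg_minnP r (P := fun j : M => label i < label j)%N ij0) => j ij j_min.
have rji : (r j < r i)%N by apply: leq_ltn_trans rj0; apply: j_min.
(* The top has the least corank, so [i] is not the top, and the exchange will fix the labels 0 and
   1. *)
have i1 : (1 < label i)%N.
  rewrite ltn_neqAle lt0n i0 andbT; apply: contraTneq rji => /esym/(nle_top j) ji.
  by rewrite -leqNgt (corank_le rP).
have j0' : label j <> 0 by lia.
have below_i t k : label t <> 0 -> (label t < label i)%N ->
    (label t < label k)%N -> (r t <= r k)%N.
  move=> t0 ti tk; rewrite leqNgt; apply/negP=> rkt.
  have : bad t by apply/andP; split; [apply/eqP|apply/existsP; exists k; rewrite tk].
  by move/i_min; rewrite leqNgt ti.
have small k : (r k < r j)%N -> (label k < label i)%N.
  move=> rkj; rewrite ltnNge leq_eqVlt; apply/negP=> /orP[/eqP/label_inj ik|].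
    by rewrite -ik in rkj; lia.
  by move/j_min; rewrite leqNgt rkj.
pose s : {perm 'I_n} := tperm (i : 'I_n) j.
have s_fix (k : M) : label k <> label i -> label k <> label j -> s k = k.
  by move=> ki kj; rewrite /s tpermD //; apply/eqP=> E; [apply: ki|apply: kj];
     rewrite /label E.
have [|M' M'E /negP not_lt] := @canonical_relabel s.
  by move=> k; rewrite -[nat_of_ord k]/(@label n M k) => k2; apply: s_fix; lia.
have s_small (k : M) : (r (s k) < r j)%N -> s k = k.
  by move=> /small ski; have := s_fix (s k); rewrite [s (s k)]tpermK => <- //; lia.
have covM' (k l : M') : covby k l = @covby _ M (s k) (s l).
  apply/esym/(mono_covby (f := s : M' -> M)) => [|a b]; last exact/esym/M'E.
  by exists s; apply: tpermK.
apply: not_lt; apply/weight_ltP; exists i => //; split.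
  have [|c ic rc] := @corank_cover _ _ _ rP i; first by have := corank_gt0 rP j; lia.
  have c0 : label c <> 0 by move/(le_label0 (ltW (covby_lt ic))); apply/eqP.
  apply: (@leq_trans (2 ^ label c)); last first.
    by rewrite /cover_weight (bigD1 c) //= leq_addr.
  apply: sum_pow2_lt => [|k]; first exact/ltnW/ltn_ord.
  rewrite covM' [s i]tpermL => /covby_lt/(corank_lt rP) rk.
  have sk := s_small _ rk; rewrite sk in rk; have ki := small _ rk.
  rewrite -[nat_of_ord k]/(@label n M k) ltnNge leq_eqVlt.
  apply/negP=> /orP[/eqP/label_inj|] ck; first by rewrite -ck in rk; lia.
  by have := below_i c k c0 (ltn_trans ck ki) ck; lia.
(* For [t] before [i], minimality of [i] gives [r t <= r j]; the covers of [t] then have corank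
   below [r j], so labels below [i], and the exchange does not move them. *)
move=> t; rewrite -[nat_of_ord t]/(@label n M t) -[nat_of_ord i]/(label i).
move=> /andP[t1 ti]; apply: eq_bigl => k; rewrite covM'.
have tj : (r t <= r j)%N by apply: below_i (ltn_trans ti ij); lia.
have -> : s t = t by apply: s_fix; lia.
apply/idP/idP => H; have rH := corank_lt rP (covby_lt H).
  by rewrite (s_small k) // in H; apply: leq_trans rH tj.
by rewrite s_fix //; have := small _ (leq_trans rH tj); move: ij; lia.
Qed.

End Relabel.

Section Restriction.
Variables (m n : nat) (L : nlattice m) (K : nlattice n) (hmn : (m <= n)%N).
Let emb (x : L) : K := widen_ord hmn (x : 'I_m).
Hypothesis emb_le : {mono emb : x y / x <= y}.
Hypothesis above : forall x y : K,
  label x <> 0 -> (label x < m)%N -> x < y -> (label y < m)%N.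

Lemma restr_onto (y : K) : (label y < m)%N -> exists x : L, y = emb x.
Proof. by move=> ym; exists (Ordinal ym : 'I_m); apply: val_inj. Qed.

(** All that lies above a nonzero [x] in [K] comes from [L]. The bottom is excluded, since its
    covers in [K] may lie outside [L]. *)
Lemma restr_covby (x y : L) : label x <> 0 -> covby (emb x) (emb y) = covby x y.
Proof.
have emb_lt := leW_mono emb_le.
move=> x0; apply/covbyP/covbyP => -[xy H];
  (split; first by rewrite ?emb_lt // -emb_lt) => z xz zy.
  by apply: (H (emb z)); rewrite emb_lt.
have [|z' zE] := @restr_onto z; first by apply: above xz => //; apply: (ltn_ord (x : 'I_m)).
by apply: (H z'); rewrite -emb_lt -zE.
Qed.

Lemma restr_cover_weight (x : L) :
  label x <> 0 -> cover_weight (emb x) = cover_weight x.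
Proof.
move=> x0; have := big_ord_narrow_cond (op := addn) (idx := 0)
  (P := fun y : 'I_n => @covby _ K (emb x) y) (F := fun y : 'I_n => 2 ^ y)%N hmn.
rewrite /cover_weight => E.
rewrite -[RHS](eq_bigl _ _ (fun y : 'I_m => restr_covby y x0)) -[RHS]E.
apply: eq_bigl => y; rewrite andb_idr // => /covby_lt; apply: above => //.
exact: (ltn_ord (x : 'I_m)).
Qed.

End Restriction.

(** The weights of [K] and [K'] begin with those of [L] and [L'], so the first difference is the
    same. *)
Lemma restr_weight_lt (m n : nat) (hmn : (m <= n)%N) (L L' : nlattice m)
    (K K' : nlattice n) :
  (forall x y, @nle m L x y = @nle n K (widen_ord hmn x) (widen_ord hmn y)) ->
  (forall x y, @nle m L' x y = @nle n K' (widen_ord hmn x) (widen_ord hmn y)) ->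
  (forall x y : K, label x <> 0 -> (label x < m)%N -> x < y -> (label y < m)%N) ->
  (forall x y : K', label x <> 0 -> (label x < m)%N -> x < y -> (label y < m)%N) ->
  ((weight L' : seqlexi nat) < weight L) -> ((weight K' : seqlexi nat) < weight K).
Proof.
move=> hL hL' aK aK' /weight_ltP[i i1 [wi wt]]; apply/weight_ltP.
exists (widen_ord hmn i) => //.
have wL (t : 'I_m) : (1 < t)%N -> @cover_weight n K (widen_ord hmn t) = @cover_weight m L t.
  move=> t1; apply: (restr_cover_weight (L := L)) => // [x y|]; first exact/esym/hL.
  by rewrite /label; lia.
have wL' (t : 'I_m) : (1 < t)%N -> @cover_weight n K' (widen_ord hmn t) = @cover_weight m L' t.
  move=> t1; apply: (restr_cover_weight (L := L')) => // [x y|]; first exact/esym/hL'.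
  by rewrite /label; lia.
split=> [|t /andP[t1 ti]]; first by rewrite wL // wL'.
have tm : (t < m)%N := ltn_trans ti (ltn_ord i).
have -> : t = widen_ord hmn (Ordinal tm) by apply: val_inj.
by rewrite wL // wL' // wt // t1.
Qed.

(** * The lattices L_m and their antichains *)

Section CanonicalModular.
Variables (N : nat) (M : nlattice N).
Hypotheses (hcan : canonical M) (hmod : modular M).
Variable r : M -> nat.
Hypothesis rP : corank r.

(** This makes the nonzero labels below any [m] an up-set of [M]. *)
Lemma label_anti (x y : M) : label x <> 0 -> x < y -> (label y < label x)%N.
Proof.
move=> x0 xy; apply: canonical_levelized (corank_lt rP xy) => //.
by move/(le_label0 (ltW xy)).
Qed.

(** Elements are matched by their labels, so that no proof of [m <= N] is needed; being boolean
    allows [xchoose] to pick the family. *)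
Definition restricts m (L : nlattice m) : bool :=
  [forall x : 'I_m, forall y : 'I_m, forall x' : 'I_N, forall y' : 'I_N,
    (x == x' :> nat) && (y == y' :> nat) ==> (@nle m L x y == @nle N M x' y')].

Lemma restrictsP m (L : nlattice m) :
  reflect (forall (x y : 'I_m) (x' y' : 'I_N), x = x' :> nat -> y = y' :> nat ->
             @nle m L x y = @nle N M x' y')
          (restricts L).
Proof.
apply: (iffP forallP) => [H x y x' y' xE yE | H x].
  move/(_ x)/forallP/(_ y)/forallP/(_ x')/forallP/(_ y'): H.
  by rewrite xE yE !eqxx => /eqP.
do 3!apply/forallP=> ?; apply/implyP=> /andP[/eqP xE /eqP yE].
exact/eqP/H.
Qed.

Lemma restriction_exists :
  exists L : forall m, nlattice m, forall m, (2 <= m <= N)%N -> restricts (L m).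
Proof.
have ex m : exists L : nlattice m, (2 <= m <= N)%N ==> restricts L.
  have [/andP[m2 mN]|_] := boolP (2 <= m <= N)%N; last by exists (chain_nlattice m).
  have [|||||L LE] := @pullback_exists m N M (widen_ord mN) => //.
  - exact: ltnW.
  - by move=> x y /(congr1 val)/= E; apply: val_inj.
  - move=> x y; set z : M := _ `|` _.
    (* A join with the bottom is the other element; any other join lies above a nonzero label below
       [m]. *)
    suff zm : (label z < m)%N by exists (Ordinal zm); apply: val_inj.
    have [x0|/eqP x0] := eqVneq (label (widen_ord mN x : M)) 0.
      have -> : z = widen_ord mN y by apply/join_idPr/label0_le.
      exact: (ltn_ord y).
    have := leUl (widen_ord mN x : M) (widen_ord mN y).
    rewrite -/z le_eqVlt => /orP[/eqP <-|]; first exact: (ltn_ord x).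
    by move/(label_anti x0)/ltn_trans; apply; apply: (ltn_ord x).
  exists L; apply/restrictsP=> x y x' y' xE yE; rewrite [LHS]LE.
  by congr (@nle N M); apply: val_inj.
exists (fun m => xchoose (ex m)) => m m2N.
exact: implyP (xchooseP (ex m)) m2N.
Qed.

Lemma restricts_full (L : nlattice N) : restricts L -> L = M.
Proof.
move=> /restrictsP LE; apply: val_inj; apply/setP=> -[x y].
exact: (LE x y x y).
Qed.

Lemma restricts_two (L : nlattice 2) : (1 < N)%N -> restricts L -> L = two_lattice.
Proof.
move=> N1 /restrictsP LE; apply: val_inj; apply/setP=> -[x y].
rewrite [RHS]inE /= -[LHS]/(@nle 2 L x y).
rewrite (LE _ _ (widen_ord N1 x) (widen_ord N1 y)) //.
case: (posnP x) => [x0|x_gt0]; first by rewrite nle_bot ?x0.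
have x1 : x = 1 :> nat by have := ltn_ord x; lia.
case: (posnP y) => [y0|y_gt0].
  rewrite x1 y0; apply/negP=> /le_label0 /(_ y0).
  by rewrite /label /= x1.
have y1 : y = 1 :> nat by have := ltn_ord y; lia.
by rewrite x1 y1 nle_top.
Qed.

(** An isomorphism from [L'] to [L] fixes 0 and 1; extended by the identity on labels from [m] on,
    it relabels [M] into an [M'] that restricts to [L']. *)
Lemma restricts_canonical m (L : nlattice m) :
  (m <= N)%N -> restricts L -> canonical L.
Proof.
move=> mN /restrictsP LE L' [f [g fK gK] f_mono]; apply/negP=> lt_w.
have f_fix (x : L') : (label x < 2)%N -> f x = x :> 'I_m.
  move=> x2; apply: val_inj; have [x0|x0] := eqVneq (label x) 0.
    have fx : f x <= (x : L) by rewrite -[X in _ <= X]gK f_mono label0_le.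
    by apply: etrans (le_label0 fx x0) (esym x0).
  have x1 : label x = 1 by lia.
  have xf : (x : L) <= f x by rewrite -[X in X <= _]gK f_mono; apply: nle_top.
  have fx : f x <= (x : L) by apply: nle_top.
  by congr val; apply: (@le_anti _ L); rewrite fx.
pose g0 (x : 'I_N) : 'I_N :=
  if insub (x : nat) is Some x' then widen_ord mN (f x') else x.
have wE (x : 'I_N) (xm : (x < m)%N) : x = widen_ord mN (Ordinal xm) by apply: val_inj.
have g0E (x : 'I_m) : g0 (widen_ord mN x) = widen_ord mN (f x).
  rewrite /g0; case: insubP => [x' _ /= E|]; last by rewrite /= ltn_ord.
  by rewrite (val_inj E : x' = x).
have g0_id (x : 'I_N) : (m <= x)%N -> g0 x = x.
  by move=> mx; rewrite /g0 insubN // -leqNgt.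
have g0_lt (x : 'I_N) : (x < m)%N -> (g0 x < m)%N.
  by move=> xm; rewrite (wE x xm) g0E; apply: (ltn_ord (f _ : 'I_m)).
have g0_inj : injective g0.
  move=> x y; have [xm|mx] := ltnP x m; have [ym|my] := ltnP y m => E.
  - move: E; rewrite (wE x xm) (wE y ym) !g0E => /(congr1 val) E.
    by congr widen_ord; apply: (can_inj fK); apply: val_inj.
  - by have := g0_lt x xm; rewrite E g0_id // ltnNge my.
  - by have := g0_lt y ym; rewrite -E g0_id // ltnNge mx.
  - by rewrite -(g0_id x) // E g0_id.
have [|M' M'E /negP] := @canonical_relabel _ _ hcan (perm g0_inj).
  move=> x x2; rewrite permE; have [xm|/g0_id//] := ltnP x m.
  rewrite (wE x xm) g0E.
  by congr widen_ord; apply: f_fix.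
apply; apply: restr_weight_lt lt_w.
- by move=> x y; apply: LE.
- by move=> x y; rewrite M'E !permE !g0E -(LE (f x) (f y)) //; apply/esym/f_mono.
- by move=> x y x0 xm /(label_anti x0)/ltn_trans; apply.
(* [M'] need not be canonical, so its up-set property is pulled back from [M]: [g0] preserves the
   labels below [m] as a set and fixes the others. *)
move=> x y x0 xm xy; rewrite ltnNge; apply/negP=> my.
have gxy : (g0 x : M) < g0 y.
  rewrite lt_neqAle (inj_eq g0_inj) (lt_eqF xy) /=.
  by have := ltW xy; rewrite /Order.le /= M'E !permE.
have gx0 : label (g0 x : M) <> 0.
  have ym : (0 < m)%N by apply: leq_ltn_trans xm.
  pose z : 'I_m := Ordinal ym; have := g0E z; rewrite (f_fix z) // => gz gx.
  apply: x0; rewrite -[0]/(label (widen_ord mN z : M)).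
  congr nat_of_ord; apply: (g0_inj); rewrite gz; exact: val_inj.
have := label_anti gx0 gxy; rewrite (g0_id y) // => /ltn_trans/(_ (g0_lt x xm)).
by rewrite ltnNge my.
Qed.

(** The existentials over [M] make this meaningful for every [m]; it is empty when no element of [M]
    is labelled [m]. *)
Definition new_covers m (L : nlattice m) : {set L} :=
  [set x : L | [exists a : M, exists b : M,
    [&& label a == m, label b == label x & covby a b]]].

(** * One extension step: adding the element labelled [m] *)

Section Step.
Variables (m : nat) (L : nlattice m).
Hypotheses (m2 : (1 < m)%N) (mN : (m < N)%N) (hL : restricts L).

Let a : M := Ordinal mN : 'I_N.
Let emb (x : L) : M := widen_ord (ltnW mN) (x : 'I_m).
Let A := new_covers L.

Let a0 : label a <> 0. Proof. by rewrite /label /=; lia. Qed.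

Let emb_le : {mono emb : x y / x <= y}.
Proof. by move=> x y; apply/esym; apply: (restrictsP _ hL). Qed.

Let emb_lt : {mono emb : x y / x < y}.
Proof. exact: leW_mono. Qed.

Let emb_lt_m (x : L) : (label (emb x) < m)%N.
Proof. exact: (ltn_ord (x : 'I_m)). Qed.

Let onto (y : M) : (label y < m)%N -> exists x : L, y = emb x.
Proof. exact: restr_onto. Qed.

Let above_a (y : M) : a < y -> exists x : L, y = emb x.
Proof. by move=> /(label_anti a0)/onto. Qed.

Let emb_covby (x y : L) : label x <> 0 -> covby (emb x) (emb y) = covby x y.
Proof.
apply: restr_covby => // {}x {}y x0 xm xy.
exact: ltn_trans (label_anti x0 xy) xm.
Qed.

Let low_corank (y : M) : label y <> 0 -> (r y < r a)%N -> exists x : L, y = emb x.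
Proof. by move=> y0 ry; apply: onto; apply: (canonical_levelized hcan rP y0 a0 ry). Qed.

Let mem_A (x : L) : (x \in A) = covby a (emb x).
Proof.
rewrite inE; apply/existsP/idP => [[b /existsP[c /and3P[/eqP bE /eqP cE]]]|ax].
  have -> : b = a by apply: val_inj.
  by have -> : c = emb x by apply: val_inj.
by exists a; apply/existsP; exists (emb x); rewrite !eqxx.
Qed.

Let A_neq0 (x : L) : x \in A -> label x <> 0.
Proof.
rewrite mem_A => /covby_lt/ltW ax x0.
by have := le_label0 ax x0; rewrite /label /=; lia.
Qed.

Let mem_upset (x : L) : (x \in upset A) = (a <= emb x).
Proof.
apply/upsetP/idP => [[y]|].
  by rewrite mem_A -emb_le => /covby_lt/ltW/le_trans; apply.
rewrite le_eqVlt => /orP[/eqP aE|/upper_cover[z az zx]].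
  by have := emb_lt_m x; rewrite -aE ltnn.
have [y yE] := above_a (covby_lt az); subst z.
by exists y; rewrite ?mem_A -?emb_le.
Qed.

Lemma new_covers_antichain : lattice_antichain A.
Proof.
apply/and4P; split.
- have N1 : (1 < N)%N by apply: ltn_trans mN.
  pose t : M := Ordinal N1 : 'I_N.
  have /upper_cover[z az _] : a < t.
    have le_at : a <= t by apply: nle_top.
    rewrite lt_neqAle le_at andbT.
    by apply/eqP=> /(congr1 (@label N M)); rewrite /label /=; lia.
  have [y yE] := above_a (covby_lt az).
  by apply/set0Pn; exists y; rewrite mem_A -yE.
- apply/forall_inP=> x xA; apply/forall_inP=> y yA; apply/implyP=> xy.
  move: xA yA; rewrite !mem_A => xA yA; apply/eqP.
  have /(congr1 (@label N M)) : emb x = emb y.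
    by apply: covby_antichain xA yA _; rewrite emb_le.
  exact: (@val_inj _ _ 'I_m).
- by apply/forall_inP=> x /A_neq0 /eqP.
apply/forall_inP=> x; rewrite mem_upset => ax.
apply/forall_inP=> y; rewrite mem_upset => ay.
have : a <= emb x `&` emb y by rewrite lexI ax.
(* If the meet in [M] is [a], the meet in [L] is 0, as only the bottom of [L] lies below [a];
   otherwise the meet is strictly above [a], hence in [L]. *)
rewrite le_eqVlt => /orP[/eqP aE|ac].
  apply/orP; left; apply/eqP.
  have wa : emb (x `&` y) <= a by rewrite aE lexI !emb_le leIl leIr.
  have [//|/eqP w0] := eqVneq (label (x `&` y)) 0.
  move: wa; rewrite le_eqVlt => /orP[/eqP wE|/(@label_anti (emb (x `&` y)) a w0)].
    by have := emb_lt_m (x `&` y); rewrite wE ltnn.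
  by move/(ltn_trans (ltn_ord (x `&` y : 'I_m))); rewrite /label ltnn.
apply/orP; right; have [c cE] := above_a ac.
rewrite mem_upset (le_trans (ltW ac)) // cE emb_le lexI -!emb_le -cE.
by rewrite leIl leIr.
Qed.

(** Only comparisons with [a] are new: nonzero elements of [L] have smaller labels, so are not below
    [a], and those above [a] form [upset A]. *)
Lemma restricts_adjoin (L1 : nlattice m.+1) :
  restricts L1 -> L1 = adjoin new_covers_antichain.
Proof.
move=> /restrictsP hL1; apply: val_inj; apply/setP=> -[x y].
rewrite [RHS]inE /= -[LHS]/(@nle _ L1 x y).
rewrite (hL1 _ _ (widen_ord mN x) (widen_ord mN y)) // /adjoin_rel.
have old (z : 'I_m) : widen_ord mN (lift ord_max z) = emb z.
  by apply: val_inj; apply: lift_max.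
have new : widen_ord mN ord_max = a by apply: val_inj.
case: (unliftP ord_max x) => [x'|] ->; case: (unliftP ord_max y) => [y'|] ->;
  rewrite ?liftK ?unlift_none ?old ?new.
- exact: emb_le.
- apply/idP/eqP => [xa|x0]; last exact: nle_bot.
  apply/eqP; apply: contraTT xa => /eqP x0; apply/negP.
  rewrite -[nle _ _]/(emb x' <= a) le_eqVlt => /orP[/eqP E|/(@label_anti (emb x') a x0)].
    by have := emb_lt_m x'; rewrite E ltnn.
  by move/(ltn_trans (ltn_ord x')); rewrite /label ltnn.
- exact/esym/mem_upset.
- exact: nle_refl.
Qed.

(* [rL] extends the corank of [M] to the bottom of [L], which is the only
   element of the level after the last nonzero one. *)
Let D := \max_(x : L | label x != 0) r (emb x).
Let rL (x : L) := if label x == 0 then D.+1 else r (emb x).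

Let rL_emb x : label x <> 0 -> rL x = r (emb x).
Proof. by rewrite /rL => /eqP/negbTE->. Qed.

Let D_attained : exists2 x : L, label x <> 0 & r (emb x) = D.
Proof.
have [|x x0 E] := @eq_bigmax_cond _ [pred x : L | label x != 0] (r \o emb).
  by apply/card_gt0P; exists (Ordinal m2 : 'I_m).
by exists x; [exact/eqP|exact/esym].
Qed.

Let le_D x : label x <> 0 -> (r (emb x) <= D)%N.
Proof. by move=> /eqP x0; rewrite /D (bigD1 x) //= leq_maxl. Qed.

(** General in [P] because [depth] counts the levels of the nonzero part, while [llev] refers to all
    of [L]. *)
Let rL_rank (P : {set L}) :
  (forall x, label x <> 0 -> x \in P) -> rank_on P rL.
Proof.
move=> Pn0; have lt_neq0 (x y : L) : x < y -> label y <> 0.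
  move=> xy y0; have := le_label0 (ltW xy) y0; rewrite -y0 => /label_inj E.
  by rewrite E ltxx in xy.
split=> [x _|x y _ _ xy|x _].
- by rewrite /rL; case: ifP => // _; apply: corank_gt0.
- rewrite (rL_emb (lt_neq0 _ _ xy)) /rL; case: ifP => [_|/eqP x0].
    by rewrite ltnS le_D //; apply: lt_neq0 xy.
  by apply: corank_lt; rewrite ?emb_lt.
- rewrite {1 3}/rL; have [x0 _|/eqP x0 r1] := eqVneq (label x) 0.
    have [y y0 yD] := D_attained; exists y; first exact: Pn0.
    rewrite rL_emb // yD; split=> //; rewrite lt_neqAle label0_le // andbT.
    by apply: contra_notN y0 => /eqP<-.
  have [y' /covby_lt xy yr] := corank_cover rP r1.
  have [|y yE] := onto (y := y').
    by apply: ltn_trans (label_anti _ xy) (emb_lt_m x).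
  subst y'; move: xy; rewrite emb_lt => xy; have y0 := lt_neq0 _ _ xy.
  by exists y; [exact: Pn0|rewrite rL_emb].
Qed.

Let depthE : depth L = D.
Proof.
apply: (nb_lev_rank (rL_rank _)) => [x /eqP x0|x|].
- by rewrite inE.
- by rewrite inE => /eqP x0; rewrite rL_emb // le_D.
- by have [x x0 xD] := D_attained; exists x; rewrite ?rL_emb ?inE //; apply/eqP.
Qed.

(** The bound on [j] keeps out the bottom, which has level [D.+1]. *)
Let mem_llev j x : (j <= D)%N ->
  reflect (label x <> 0 /\ r (emb x) = j) (x \in llev L j).
Proof.
move=> jD; rewrite /llev (lev_rank _ (rL_rank _)) => [|? _]; last by rewrite inE.
rewrite inE in_setT /=; apply: (iffP eqP) => [|[x0 <-]]; last exact: rL_emb.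
rewrite /rL; have [_ E|/eqP x0 //] := eqVneq (label x) 0.
by move: jD; rewrite -E ltnn.
Qed.

Let corank_A x : x \in A -> r a = (r (emb x)).+1.
Proof. by rewrite mem_A => /(corank_covby rP hmod). Qed.

Let A_nonempty : exists x, x \in A.
Proof. by case/and4P: new_covers_antichain => /set0Pn. Qed.

(** Labels in [L] are smaller than that of [a], so nonzero coranks there are at most [r a]; elements
    of [A] attain [r a - 1]. *)
Let D_bounds : (D <= r a <= D.+1)%N.
Proof.
apply/andP; split.
  have [x x0 <-] := D_attained; rewrite leqNgt; apply/negP.
  by move=> /(@canonical_levelized _ _ hcan _ rP a (emb x) a0 x0); rewrite ltnNge ltnW // emb_lt_m.
have [x xA] := A_nonempty; rewrite (corank_A xA) ltnS le_D //; exact: A_neq0.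
Qed.

Let bottom_corank (x : M) : label x = 0 -> (r a < r x)%N.
Proof.
move=> x0; apply: corank_lt => //; rewrite lt_neqAle label0_le // andbT.
by apply/eqP=> xa; apply: a0; rewrite -xa.
Qed.

Let bottom_D : A \subset llev L (depth L) -> r a = D.+1.
Proof.
have [x xA] := A_nonempty; rewrite (corank_A xA) depthE => /subsetP/(_ x xA).
by case/mem_llev=> // _ ->.
Qed.

Lemma new_covers_A1 : condA1 A.
Proof.
rewrite /condA1 depthE; have /andP[Da aD] := D_bounds.
have [E|aD'] := eqVneq (r a) D; [left|right]; apply/subsetP=> x xA;
  apply/mem_llev; have := corank_A xA; have := A_neq0 xA; by [|lia].
Qed.

(** A lower cover in [M] of an element of level [D - 1] has corank [D < r a], so it is a nonzero
    element of [L], and the given element is no atom. *)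
Lemma new_covers_A2 : condA2 A.
Proof.
move=> /bottom_D aD x; rewrite depthE => /mem_llev[|x0 rx]; first exact: leq_pred.
have D_gt0 : (0 < D)%N by have := corank_gt0 rP (emb x); lia.
apply/existsP=> -[z /andP[/eqP z0 zx]].
have /lower_cover[y yx zy] : emb z < emb x by rewrite emb_lt covby_lt.
have ry := corank_covby rP hmod yx.
have y0 : label y <> 0 by move=> /bottom_corank; lia.
have [|w wE] := low_corank y0; first lia.
subst y; case/covbyP: zx => _ /(_ w); apply; last by rewrite -emb_lt covby_lt.
rewrite lt_neqAle label0_le // andbT; apply/eqP=> zw.
by apply: y0; rewrite -zw.
Qed.

(** The join in [M] covers both elements by modularity, and lies in [L] because it is above [a]. *)
Lemma new_covers_A3 : condA3 A.
Proof.
move=> x y xA yA xy; have [x0 y0] := (A_neq0 xA, A_neq0 yA).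
move: xA yA; rewrite !mem_A => ax ay.
have embxy : emb x != emb y.
  by apply: contra_neq xy => /(congr1 (@label N M)); exact: (@val_inj _ _ 'I_m).
have xj := modular_upper hmod ax ay embxy.
have yj : covby (emb y) (emb x `|` emb y).
  by rewrite joinC; apply: modular_upper ay ax _; rewrite // eq_sym.
have [z zE] := above_a (lt_trans (covby_lt ax) (covby_lt xj)).
by exists z; rewrite -!emb_covby // -zE xj.
Qed.

(** Joins in [L] and [M] agree. The meet in [M] is covered by both elements, so its corank is
    [D < r a]; it is therefore in [L] and nonzero. *)
Lemma new_covers_A4 : condA4 A.
Proof.
move=> /bottom_D aD x y; rewrite depthE => /mem_llev[|x0 rx]; first exact: leq_pred.
move=> /mem_llev[|y0 _]; first exact: leq_pred.
have D_gt0 : (0 < D)%N by have := corank_gt0 rP (emb x); lia.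
have joinE : emb (x `|` y) = emb x `|` emb y.
  have [|j jE] := onto (y := emb x `|` emb y).
    have := leUl (emb x) (emb y); rewrite le_eqVlt => /orP[/eqP <-|].
      exact: emb_lt_m.
    by move/(@label_anti (emb x) _ x0)/ltn_trans; apply; apply: emb_lt_m.
  apply/le_anti; rewrite leUx !emb_le leUl leUr andbT jE emb_le leUx.
  by rewrite -!emb_le -jE leUl leUr.
rewrite -(@emb_covby x _ x0) -(@emb_covby y _ y0) joinE => xj yj.
have wx := modular_lower hmod xj yj.
have wy : covby (emb x `&` emb y) (emb y).
  by rewrite meetC; apply: modular_lower; rewrite // joinC.
have rw := corank_covby rP hmod wx.
have w0 : label (emb x `&` emb y) <> 0 by move=> /bottom_corank; lia.
have [|w wE] := low_corank w0; first lia.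
have -> : x `&` y = w.
  apply/le_anti; rewrite lexI -!emb_le -wE leIl leIr !andbT lexI !emb_le.
  by rewrite leIl leIr.
have w0' : label w <> 0 by rewrite wE in w0.
by rewrite -!emb_covby // -wE.
Qed.

End Step.

End CanonicalModular.

Local Close Scope order_scope.

Theorem theorem3p7 (N : nat) (hN : 2 <= N) (M : nlattice N)
    (hcan : canonical M) (hmod : modular M) :
  exists (L : forall m : nat, nlattice m) (A : forall m : nat, {set L m}),
    [/\ L 2 = two_lattice,
        L N = M,
        (forall m : nat, 2 <= m <= N -> canonical (L m)) &
        (forall m : nat, 2 <= m < N ->
           exists hA : lattice_antichain (A m),
             [/\ condA1 (A m), condA2 (A m), condA3 (A m), condA4 (A m) &
                 L m.+1 = adjoin hA])].
Proof.
have [r rP] := corank_exists M.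
have [L LM] := restriction_exists hcan rP.
exists L, (fun m => new_covers M (L m)); split=> [|||m /andP[m2 mN]].
- exact: (restricts_two hN (LM 2 hN)).
- by apply/restricts_full/LM; rewrite hN leqnn.
- move=> m m2N; apply: (restricts_canonical hcan rP) (LM m m2N).
  by case/andP: m2N.
have Lm : restricts M (L m) by apply: LM; rewrite m2 ltnW.
exists (new_covers_antichain hcan rP m2 mN Lm); split.
- exact: new_covers_A1 Lm.
- exact: new_covers_A2 Lm.
- exact: new_covers_A3 Lm.
- exact: new_covers_A4 Lm.
- by apply: restricts_adjoin; apply: LM; rewrite (leq_trans m2).
Qed.
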